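(* Let $\mathbb H^d$ denote real hyperbolic $d$-space. Then $\mathrm{TO}^q_{\mathbb{H}^d}(r) \lesssim r^{1-1/(d-q)}$ for $2 \leq q \leq d-2$, and $\mathrm{TO}^{d-1}_{\mathbb{H}^d}(r)\lesssim \ln(1+r)^2$.
   Context: For a metric space $X$ and $Z\subseteq X$, $\mathrm{Cov}^1(Z)$ is the minimal number of closed radius-$1$ balls of $X$ covering $Z$. For continuous $f:Z\to\mathbb R^q$, $\mathrm{Ov}(f)=\sup_{z}\mathrm{Cov}^1(f^{-1}(z))$, $\mathrm{TO}^q(Z)=\min_f\mathrm{Ov}(f)$, $\mathrm{TO}^q_X(r)=\max\{\mathrm{TO}^q(Z): Z\subseteq X,\mathrm{Cov}^1(Z)\le r\}$. $f\lesssim g$ means there is $C$ with $f(r)\le Cg(Cr)+C$ for all $r$. *)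

(* Defs.v *)
From HB Require Import structures.
From mathcomp Require Import all_boot all_order all_algebra.
From mathcomp Require Import all_classical all_reals all_analysis.
From mathcomp Require Import Rstruct Rstruct_topology.
Unset Printing Implicit Defensive.
Import Order.TTheory GRing.Theory Num.Theory.
Local Open Scope classical_set_scope.
Local Open Scope ring_scope.

Notation R := Rdefinitions.R.

Definition lor (d : nat) (x y : R * 'rV[R]_d) : R :=
  x.1 * y.1 - \sum_(i < d) x.2 0 i * y.2 0 i.

(* Hyperboloid model of real hyperbolic d-space H^d (upper sheet). *)
Definition Hyp (d : nat) : set (R * 'rV[R]_d) :=
  [set x | 0 < x.1 /\ @lor d x x = 1].

(* Hyperbolic distance: arcosh of the Lorentz product. *)
Definition hdist (d : nat) (x y : R * 'rV[R]_d) : R :=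
  ln (@lor d x y + Num.sqrt (@lor d x y ^+ 2 - 1)).

Definition edist (q : nat) (u v : 'rV[R]_q) : R :=
  Num.sqrt (\sum_(i < q) (u 0 i - v 0 i) ^+ 2).

Definition covered_by (d : nat) (Z : set (R * 'rV[R]_d)) (n : nat) : Prop :=
  exists cs : seq (R * 'rV[R]_d),
    (size cs <= n)%N /\ (forall c, c \in cs -> Hyp d c) /\
    (forall z, Z z -> exists2 c, c \in cs & @hdist d c z <= 1).

(* Cov^1(Z): minimal number of closed unit balls covering Z (+oo if none). *)
Definition Cov1 (d : nat) (Z : set (R * 'rV[R]_d)) : \bar R :=
  ereal_inf [set (n%:R)%:E | n in [set n | covered_by d Z n]].

Definition cont_on (d q : nat) (Z : set (R * 'rV[R]_d))
    (f : R * 'rV[R]_d -> 'rV[R]_q) : Prop :=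
  forall x, Z x -> forall eps : R, 0 < eps -> exists2 del : R, 0 < del &
    forall y, Z y -> @hdist d x y < del -> @edist q (f x) (f y) < eps.

Definition Ov (d q : nat) (Z : set (R * 'rV[R]_d))
    (f : R * 'rV[R]_d -> 'rV[R]_q) : \bar R :=
  ereal_sup [set @Cov1 d [set x | Z x /\ f x = z] | z in [set: 'rV[R]_q]].

Definition TO (d q : nat) (Z : set (R * 'rV[R]_d)) : \bar R :=
  ereal_inf [set @Ov d q Z f | f in [set f | @cont_on d q Z f]].

Definition TOX (d q : nat) (r : R) : \bar R :=
  ereal_sup [set @TO d q Z | Z in [set Z | Z `<=` Hyp d /\ (@Cov1 d Z <= r%:E)%E]].

Definition lesssim (F : R -> \bar R) (g : R -> R) : Prop :=
  exists C : R, 0 < C /\ forall r : R, 0 <= r -> (F r <= (C * g (C * r) + C)%:E)%E.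

(* Main.v *)
Require Import Defs.
From HB Require Import structures.
From mathcomp Require Import all_boot all_order all_algebra.
From mathcomp Require Import all_classical all_reals all_analysis.
From mathcomp Require Import Rstruct Rstruct_topology.
From mathcomp Require Import zify ring lra.
Import Order.TTheory GRing.Theory Num.Theory.
Local Open Scope ring_scope.

(** Work in the upper half-space model and put m = d - q.  Dropping q - 1 of the
    horizontal coordinates maps H^d to H^{m+1} without increasing distances, and
    its fibres are isometric copies of H^{m+1}.  Hence, if a function h on H^{m+1}
    has level sets that meet few unit-size cells of the projection of Z, pairing
    the dropped coordinates with h gives a map Z -> R^q with small fibres, and the
    problem reduces to q = 1.

    In H^{m+1}, let P be a set of N dyadic cells.  Take the smallest dyadic s for
    which some box {max(y, |x - a|) <= s} contains a fixed proportion of P; by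
    minimality, doubling the box captures at most half of P.  Among N parallel
    shells between the two boxes, one meets only about the average number of
    cells.  A cell of size 2^-i s meets about a proportion 2^-i of the shells and
    there are O(2^{im}) such cells near the box, so this average is O(N^{1-1/m})
    for m >= 2 and O(ln N) for m = 1.  Sweep the inside of the shell first, then
    the outside, recursively: the costs form a geometric series when m >= 2, and
    sum to O((ln N)^2) when m = 1. *)

(** * Dyadic cells of the upper half-space, and boxes standing on its boundary *)

Lemma int_window (K : realType) (al w : K) (k : nat) : w < k%:R ->
  exists b : int, forall j : int, al <= j%:~R <= al + w ->
    exists t : 'I_k, j = b + (t : nat)%:Z.
Proof.
move=> wk; exists (Num.ceil al) => j /andP[aj jw].
have bj : Num.ceil al <= j by rewrite Num.Theory.ceil_le_int.
have /(_ al) := @Num.Theory.ceil_ge K => ba.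
have : (j - Num.ceil al)%:~R < (k%:Z)%:~R :> K.
  by rewrite rmorphB /= -pmulrn; lra.
rewrite ltr_int => jk.
have tk : (`|j - Num.ceil al| < k)%N by lia.
by exists (Ordinal tk) => /=; lia.
Qed.

Lemma dyadic_level (K : realType) (y : K) : 0 < y ->
  exists n : int, 2 ^ n <= y < 2 * 2 ^ n.
Proof.
move=> y0; have ln2 : 0 < ln (2 : K) by rewrite ln_gt0// ltr1n.
pose n := Num.floor (ln y / ln 2); exists n.
have E (k : int) : (2 : K) ^ k = expR (k%:~R * ln 2).
  by rewrite -powR_intmul// /powR pnatr_eq0.
have /andP[n1 n2] := @Num.Theory.floor_itv K (ln y / ln 2).
rewrite -/n in n1 n2.
rewrite -{2}[2]expr1z -expfzDr// addrC !E -{1 2}(lnK y0) ler_expR ltr_expR.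
rewrite -ler_pdivlMr// n1 /=.
by rewrite -ltr_pdivrMr.
Qed.

Section cells.
Context (K : realType) (m : nat).

(* The cell (n, j) of the upper half-space is the set of (x, y) with y in
   [2^n, 2^(n+1)[ and x_i in 2^n / (m + 1) * [j_i, j_i + 1]; the factor m + 1
   makes every cell fit in a hyperbolic unit ball. *)
Definition cell := (int * {ffun 'I_m -> int})%type.

Definition cell_len (Q : cell) : K := 2 ^ Q.1.

Definition corner (Q : cell) (i : 'I_m) : K := cell_len Q * (Q.2 i)%:~R / m.+1%:R.

Definition in_cell (Q : cell) (x : 'I_m -> K) (y : K) : Prop :=
  cell_len Q <= y < 2 * cell_len Q /\
  forall i, corner Q i <= x i <= corner Q i + cell_len Q / m.+1%:R.

Lemma len_gt0 (Q : cell) : 0 < cell_len Q.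
Proof. by rewrite /cell_len exprz_gt0. Qed.

Lemma exists_cell (x : 'I_m -> K) (y : K) : 0 < y -> exists Q, in_cell Q x y.
Proof.
move=> /dyadic_level[n ny].
pose j := [ffun i => Num.floor (m.+1%:R * x i / 2 ^ n) : int].
exists (n, j); split => // i; rewrite /corner /cell_len /= ffunE.
have l0 : 0 < (2 : K) ^ n by rewrite exprz_gt0.
have /andP[] := @Num.Theory.floor_itv K (m.+1%:R * x i / 2 ^ n).
rewrite ler_pdivlMr// ltr_pdivrMr// rmorphD /= => h1 h2.
rewrite -mulrDl ler_pdivrMr// ler_pdivlMr//.
by apply/andP; split; lra.
Qed.

Lemma cell_window (n : int) (al : 'I_m -> K) (w : K) (k : nat) : w < k%:R ->
  exists2 cs : seq cell, size cs = (k ^ m)%N &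
    forall Q : cell, Q.1 = n -> (forall i, al i <= (Q.2 i)%:~R <= al i + w) -> Q \in cs.
Proof.
move=> wk; have [b bP] := choice (fun i => int_window _ (al i) w k wk).
exists [seq (n, [ffun i => b i + (t i : nat)%:Z]) | t : {ffun 'I_m -> 'I_k}].
  by rewrite size_map -cardE card_ffun !card_ord.
move=> [n' j] /= -> jP.
have [t tP] := choice (fun i => bP i _ (jP i)).
apply/mapP; exists [ffun i => t i]; first by rewrite mem_enum.
by congr pair; apply/ffunP => i; rewrite !ffunE -tP.
Qed.

(** The corners at level [n] form a lattice of spacing [2 ^ n / m.+1], so each index [Q.2 i] runs
    over an interval of length [2 * D * m.+1 / 2 ^ n < k]. *)
Lemma count_window (P : seq cell) (n : int) (a : 'I_m -> K) (D : K) (k : nat) :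
  uniq P -> 2 * D * m.+1%:R < k%:R * 2 ^ n ->
  (count (fun Q => (Q.1 == n) && [forall i, `|corner Q i - a i| <= D]%R) P
    <= k ^ m)%N.
Proof.
move=> uP Dk; have l0 : 0 < (2 : K) ^ n by rewrite exprz_gt0.
have m0 : 0 < (m.+1%:R : K) by rewrite ltr0Sn.
have wk : 2 * D * m.+1%:R / 2 ^ n < k%:R by rewrite ltr_pdivrMr.
have [cs szcs csP] := cell_window n (fun i => (a i - D) * m.+1%:R / 2 ^ n) _ _ wk.
rewrite -szcs -size_filter; apply: uniq_leq_size; first exact: filter_uniq.
move=> Q; rewrite mem_filter => /andP[/andP[/eqP Qn /forallP Qa] _].
apply: csP => // i; have := Qa i.
rewrite ler_norml /corner /cell_len Qn => /andP[h1 h2].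
rewrite -mulrDl ler_pdivrMr// ler_pdivlMr//.
move: h1 h2; set c := _ / m.+1%:R => h1 h2.
have -> : (Q.2 i)%:~R * 2 ^ n = c * m.+1%:R by rewrite /c mulfVK ?gt_eqF// mulrC.
rewrite -mulrDl !ler_pM2r//; apply/andP; split; lra.
Qed.

(** Starting the maximum at [y] makes the sublevel sets boxes that bound the height as well. *)
Definition boxgauge (a x : 'I_m -> K) (y : K) : K :=
  \big[Num.max/y]_(i < m) `|x i - a i|.

Lemma boxgauge_le (a x : 'I_m -> K) (y s : K) :
  reflect (y <= s /\ forall i, `|x i - a i| <= s) (boxgauge a x y <= s).
Proof.
apply: (iffP (bigmax_leP _ _ _ _)) => -[ys xs]; split=> // *; exact: xs.
Qed.

Lemma boxgauge_ge (a x : 'I_m -> K) (y : K) : y <= boxgauge a x y.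
Proof. by have /boxgauge_le[] := lexx (boxgauge a x y). Qed.

Lemma boxgauge_ge_coord (a x : 'I_m -> K) (y : K) i :
  `|x i - a i| <= boxgauge a x y.
Proof. by have /boxgauge_le[_] := lexx (boxgauge a x y). Qed.

Lemma boxgauge_shift (a x x' : 'I_m -> K) (y y' D : K) :
  y <= y' + D -> (forall i, `|x i - x' i| <= D) ->
  boxgauge a x y <= boxgauge a x' y' + D.
Proof.
move=> yD xD; apply/boxgauge_le; split.
  by apply: (le_trans yD); rewrite lerD2r boxgauge_ge.
move=> i; have -> : x i - a i = (x' i - a i) + (x i - x' i) by ring.
by apply: (le_trans (ler_normD _ _)); rewrite lerD// boxgauge_ge_coord.
Qed.

(** From the corner to a point of the cell the height only grows, by at most [cell_len Q];
    horizontal coordinates move by at most half of it, since [m.+1 >= 2]. *)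
Lemma cell_boxgauge (a : 'I_m -> K) (Q : cell) (x : 'I_m -> K) (y : K) :
  (0 < m)%N -> in_cell Q x y ->
  boxgauge a (corner Q) (cell_len Q) - cell_len Q / 2 <= boxgauge a x y
    <= boxgauge a (corner Q) (cell_len Q) + cell_len Q.
Proof.
move=> m0 [/andP[y1 y2] xQ]; have l0 := len_gt0 Q.
have e : cell_len Q / m.+1%:R <= cell_len Q / 2.
  by rewrite ler_pM2l// lef_pV2 ?posrE// ler_nat.
move: e xQ; set w := cell_len Q / _ => e xQ.
rewrite lerBlDr; apply/andP; split; apply: boxgauge_shift; try lra.
  by move=> i; have /andP[] := xQ i => h1 h2; rewrite ler_norml; apply/andP; split; lra.
by move=> i; have /andP[] := xQ i => h1 h2; rewrite ler_norml; apply/andP; split; lra.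
Qed.

End cells.

(** * Counting and averaging *)

Lemma count_cover (T : eqType) (I : finType) (p b : pred T) (f : I -> pred T)
    (P : seq T) :
  (forall Q, p Q -> b Q || [exists t, f t Q]) ->
  (count p P <= count b P + \sum_t count (f t) P)%N.
Proof.
move=> pbf; elim: P => [|Q P IH] //=; rewrite big_split /= addnACA leq_add//.
case: (boolP (p Q)) => // /pbf /orP[->//|/existsP[t ft]].
by rewrite (bigD1 t)//= ft addnCA.
Qed.

Lemma card_ord_window (K : realType) (N : nat) (al w : K) : 0 <= w ->
  (#|[pred j : 'I_N | al <= (j : nat)%:R <= al + w]|)%:R <= w + 1.
Proof.
move=> w0; pose k := (Num.truncn w).+1.
have wk : w < k%:R by rewrite /k -Num.Theory.truncn_lt_nat.
have kw : (k%:R : K) <= w + 1 by rewrite /k -natr1 lerD2r Num.Theory.truncn_le.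
apply: le_trans kw; rewrite ler_nat.
have [b bP] := int_window _ al w k wk.
rewrite cardE -(size_map (fun j : 'I_N => (j : nat)%:Z)).
rewrite -[leqRHS](size_enum_ord k) -(size_map (fun t : 'I_k => b + (t : nat)%:Z)).
apply: uniq_leq_size.
  by rewrite map_inj_uniq ?enum_uniq// => i j [/ord_inj].
move=> z /mapP[j]; rewrite mem_enum inE pmulrn => /bP[t jt ->]; rewrite jt.
 apply/mapP; exists t => //; exact: mem_enum.
Qed.

Lemma natr_count (K : realType) (T : Type) (p : pred T) (P : seq T) :
  (count p P)%:R = \sum_(Q <- P) (p Q)%:R :> K.
Proof. by elim: P => [|Q P IH]; rewrite ?big_nil// big_cons /= natrD IH. Qed.

Lemma exists_le_average (K : realType) (N : nat) (u : 'I_N -> K) (A : K) :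
  (0 < N)%N -> \sum_j u j <= N%:R * A -> exists j, u j <= A.
Proof.
move=> N0 uA; apply: contrapT => /forallNP hu.
have : \sum_(j < N) A < \sum_j u j.
  apply: ltr_sum => [|i _]; first by apply/hasP; exists (Ordinal N0); rewrite ?mem_index_enum.
  by have /negP := hu i; rewrite -ltNge.
by rewrite sumr_const card_ord -mulr_natl ltNge uA.
Qed.

(** * Balanced separation of a finite set of cells by a shell *)

Section separator.
Context (K : realType) (m : nat).
Implicit Types (P : seq (cell m)) (Q : cell m) (a : 'I_m -> K).
Local Notation len := (cell_len K m).
Local Notation corner := (corner K m).

Definition gauge a Q : K := boxgauge K m a (corner Q) (len Q).

Lemma exists_heavy_box P (del : K) : 0 < del <= 1 -> (0 < size P)%N ->
  exists (n : int) a,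
    del * (size P)%:R <= (count (fun Q => gauge a Q <= 2 ^ n)%R P)%:R /\
    forall b, (count (fun Q => gauge b Q <= 2 ^ n / 2)%R P)%:R < del * (size P)%:R.
Proof.
move=> /andP[d0 d1] P0.
have [n1 n1P] : exists n1 : int, forall Q, Q \in P -> n1 <= Q.1.
  elim: P {P0} => [|Q P [n1 n1P]]; first by exists 0.
  exists (Num.min n1 Q.1) => Q'; rewrite inE => /orP[/eqP ->|/n1P h].
    by rewrite ge_min lexx orbT.
  by rewrite ge_min h.
have [M MP] : exists M : K, forall Q, Q \in P -> gauge (fun=> 0) Q <= M.
  elim: P {P0 n1P} => [|Q P [M MP]]; first by exists 0.
  exists (Num.max M (gauge (fun=> 0) Q)) => Q'; rewrite inE => /orP[/eqP ->|/MP h].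
    by rewrite le_max lexx orbT.
  by rewrite le_max h.
have pw k : (2 : K) ^ (n1 - 1 + (k : nat)%:Z) = 2 ^ (n1 - 1) * 2 ^+ k.
  by rewrite expfzDr.
have l0 : 0 < (2 : K) ^ (n1 - 1) by rewrite exprz_gt0.
(* Scales start at [n1 - 1], below every cell size: the gauge of a cell is at least its length, so
   [T 0] fails and the minimal index has a predecessor. *)
pose T k := `[< exists a, del * (size P)%:R <=
  (count (fun Q => gauge a Q <= 2 ^ (n1 - 1 + (k : nat)%:Z))%R P)%:R >].
have exT : exists k, T k.
  exists (Num.bound (M / 2 ^ (n1 - 1))); apply/asboolP; exists (fun=> 0).
  have /eqP -> : count (fun Q => gauge (fun=> 0) Q <=
      2 ^ (n1 - 1 + (Num.bound (M / 2 ^ (n1 - 1)))%:Z))%R P == size P.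
    rewrite -all_count; apply/allP => Q /MP /le_trans; apply.
    rewrite pw mulrC -ler_pdivrMr//.
    apply: (le_trans (ler_norm _)).
    apply: (le_trans (ltW (Num.Theory.archi_boundP (normr_ge0 _)))).
    rewrite -natrX ler_nat.
    by rewrite /Num.bound normr_id ltnW // ltn_expl.
  by rewrite -[leRHS]mul1r ler_wpM2r.
case: (ex_minnP exT) => -[|k] /asboolP[a aP] kmin.
  exfalso; move: aP; have -> : count (fun Q => gauge a Q <= 2 ^ (n1 - 1 + 0%:Z))%R P = 0%N.
    apply/eqP; rewrite -leqn0 leqNgt -has_count; apply/hasPn => Q /n1P nQ.
    rewrite -ltNge; apply: lt_le_trans (boxgauge_ge _ _ _ _ _).
    rewrite addr0 /cell_len; apply: lt_le_trans (_ : 2 ^ n1 <= _).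
      by rewrite ltr_eXz2l ?ltr1n//; lia.
    by rewrite ler_eXz2l ?ltr1n.
  by apply/negP; rewrite -ltNge mulr_gt0// ltr0n.
exists (n1 - 1 + k.+1%:Z), a; split=> // b; rewrite ltNge; apply/negP => bP.
suff /kmin : T k by rewrite ltnn.
apply/asboolP; exists b; apply: (le_trans bP); rewrite le_eqVlt; apply/orP; left.
apply/eqP; congr (_%:R); apply: eq_count => Q; congr (_ <= _).
by rewrite !pw exprSr mulrA mulfK.
Qed.

(** With [s = 2 ^ n], cells of length at most [s / 2] are caught by a grid of [4 ^ m] boxes of size
    [s / 2]. The others have level [n] or [n + 1] and are counted by volume. *)
Lemma count_double_box P (n : int) a (B : K) : uniq P ->
  (forall b, (count (fun Q => gauge b Q <= 2 ^ n / 2)%R P)%:R <= B) ->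
  (count (fun Q => gauge a Q <= 2 * 2 ^ n)%R P)%:R <=
    2 * (4 * m.+1 + 1)%:R ^+ m + 4 ^+ m * B.
Proof.
move=> uP BP; set s := (2 : K) ^ n; have s0 : 0 < s by rewrite exprz_gt0.
pose c (t : {ffun 'I_m -> 'I_4}) i := a i - 2 * s + s / 2 + s * (t i : nat)%:R.
pose big (l : int) Q := (Q.1 == l) && [forall i, `|corner Q i - a i| <= 2 * s].
have bigle l : n <= l -> (count (big l) P <= (4 * m.+1 + 1) ^ m)%N.
  move=> nl; apply: count_window => //.
  have h : s <= 2 ^ l by rewrite ler_eXz2l ?ltr1n.
  have m0 : 0 < (m.+1%:R : K) by rewrite ltr0Sn.
  apply: (lt_le_trans (_ : _ < (4 * m.+1 + 1)%:R * s)).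
    by rewrite natrD natrM; nra.
  by rewrite ler_wpM2l.
have : (count (fun Q => gauge a Q <= 2 * s)%R P <=
   count (predU (big n) (big (n + 1)%R)) P +
   \sum_t count (fun Q => gauge (c t) Q <= s / 2)%R P)%N.
  apply: count_cover => Q /boxgauge_le[lenQ xQ].
  have [lQ|lQ] := leP (len Q) (s / 2).
    apply/orP; right; apply/existsP.
    have /choice[t tP] : forall i, exists u : 'I_4,
        `|corner Q i - (a i - 2 * s + s / 2 + s * (u : nat)%:R)| <= s / 2.
      move=> i; have := xQ i; rewrite ler_norml => /andP[h1 h2].
      have [h3|h3] := leP (corner Q i - a i) (- s).
        exists (@Ordinal 4 0 isT) => /=; rewrite ler_norml mulr0; apply/andP; split; lra.
      have [h4|h4] := leP (corner Q i - a i) 0.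
        exists (@Ordinal 4 1 isT) => /=; rewrite ler_norml mulr1; apply/andP; split; lra.
      have [h5|h5] := leP (corner Q i - a i) s.
        exists (@Ordinal 4 2 isT) => /=; rewrite ler_norml; apply/andP; split; lra.
      exists (@Ordinal 4 3 isT) => /=; rewrite ler_norml; apply/andP; split; lra.
    exists [ffun i => t i]; apply/boxgauge_le; split=> // i.
    by rewrite /c ffunE tP.
  apply/orP; left; rewrite /= /big.
  have -> : [forall i, `|corner Q i - a i| <= 2 * s] by apply/forallP.
  rewrite !andbT.
  have l1 : n - 1 < Q.1.
    rewrite -(@ltr_eXz2l K 2) ?ltr1n//; apply: le_lt_trans lQ.
    by rewrite expfzDr// exprN1.
  have l2 : Q.1 <= n + 1.
    by rewrite -(@ler_eXz2l K 2) ?ltr1n// expfzDr// mulrC expr1z.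
  move: (Q.1) l1 l2 => z l1 l2; clear -l1 l2.
  lia.
rewrite -(ler_nat K) natrD => /le_trans; apply; apply: lerD.
  have h : (count (predU (big n) (big (n + 1)%R)) P <= 2 * (4 * m.+1 + 1) ^ m)%N.
    apply: leq_trans (_ : (count (big n) P + count (big (n + 1)%R) P <= _)%N).
      by rewrite -count_predUI leq_addr.
    by rewrite mul2n -addnn leq_add// bigle//; lia.
  by rewrite -natrX -natrM ler_nat.
rewrite natr_sum; apply: (le_trans (ler_sum _ (fun t _ => BP (c t)))).
by rewrite sumr_const card_ffun !card_ord -[leLHS]mulr_natl natrX.
Qed.

(* Cells of size 2^(n + 2 - i) that reach the box of size 2^(n + 1) are counted
   by volume when i <= I and by the size of P when i > I. *)
Lemma relevant_sum P (n : int) a (I : nat) : (0 < m)%N -> uniq P ->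
  \sum_(Q <- P | gauge a Q - len Q / 2 <= 2 * 2 ^ n) len Q / 2 ^ n <=
  4 * ((2 * m + 3)%:R ^+ m * (\sum_(i < I.+1) 2 ^+ (i * m.-1)) +
       (size P)%:R / 2 ^+ I).
Proof.
move=> m0 uP; set s := (2 : K) ^ n; have s0 : 0 < s by rewrite exprz_gt0.
pose b (i : nat) Q := (Q.1 == n + 2 - i%:Z) &&
  [forall j, `|corner Q j - a j| <= 4 * s].
have lenE (k : nat) : (2 : K) ^ (n + 2 - k%:Z) = 4 * s / 2 ^+ k.
  rewrite !expfzDr// expr1z -exprnN -/s; congr (_ / _); ring.
have p0 k : 0 < (2 : K) ^+ k by rewrite exprn_gt0.
have cb i : (count (b i) P <= ((2 * m + 3) * 2 ^ i) ^ m)%N.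
  apply: count_window => //; rewrite lenE natrM natrX natrD natrM -addn1 natrD.
  rewrite [ltRHS](_ : _ = (2 * m%:R + 3) * (4 * s)); first by lra.
  by field; rewrite gt_eqF.
rewrite big_mkcond /=.
apply: (@le_trans _ _ (\sum_(Q <- P)
   4 * (\sum_(i < I.+1) (b i Q)%:R / 2 ^+ i + 1 / 2 ^+ I))).
  apply: ler_sum => Q _.
  have S0 : 0 <= \sum_(i < I.+1) (b i Q)%:R / (2 : K) ^+ i.
    by apply: sumr_ge0 => i _; rewrite divr_ge0// ltW.
  have I0 : 0 <= 1 / (2 : K) ^+ I by rewrite divr_ge0// ltW.
  case: ifPn => [rel|_]; last by rewrite mulr_ge0// addr_ge0.
  (* Relevance now gives [gauge a Q / 2 <= 2 * s]: the level is at most [n + 2] and the corner is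
     within [4 * s] of [a]. *)
  have gl : len Q <= gauge a Q := boxgauge_ge _ _ _ _ _.
  have l4 : len Q <= 4 * s by lra.
  have g4 : gauge a Q <= 4 * s by lra.
  have /boxgauge_le[_ xQ] := g4.
  have lQ : Q.1 <= n + 2.
    rewrite -(@ler_eXz2l K 2) ?ltr1n// !expfzDr// expr1z -/s.
    by move: l4; rewrite /cell_len; lra.
  pose k := `|(n + 2 - Q.1)%R|%N.
  have Qk : Q.1 = n + 2 - k%:Z by rewrite /k; lia.
  have -> : len Q / s = 4 * (1 / 2 ^+ k).
    by rewrite /cell_len Qk lenE; field; rewrite gt_eqF// gt_eqF.
  rewrite ler_pM2l//.
  have [kI|Ik] := ltnP k I.+1.
    rewrite (bigD1 (Ordinal kI))//= {1}/b Qk eqxx /=.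
    have -> : [forall j, `|corner Q j - a j| <= 4 * s] by apply/forallP.
    rewrite -addrA lerDl addr_ge0//.
    by apply: sumr_ge0 => i _; rewrite divr_ge0// ltW.
  apply: le_trans (_ : 1 / 2 ^+ I <= _); last by rewrite lerDr.
  by rewrite ler_pM2l// lef_pV2 ?posrE// ler_eXn2l ?ltr1n// ltnW.
rewrite -mulr_sumr ler_pM2l// big_split /= lerD//; last first.
  by rewrite big_const_seq count_predT iter_addr_0 -[leLHS]mulr_natl mul1r.
(* At most [((2 * m + 3) * 2 ^ i) ^ m] cells, each of weight [2 ^- i], produce the term
   [2 ^+ (i * m.-1)]. *)
rewrite exchange_big /= mulr_sumr; apply: ler_sum => i _.
rewrite -mulr_suml -natr_count ler_pdivrMr// -mulrA.
apply: le_trans (_ : (((2 * m + 3) * 2 ^ i) ^ m)%:R <= _); first by rewrite ler_nat.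
rewrite natrX natrM exprMn natrX ler_wpM2l ?exprn_ge0//.
by rewrite -exprM -exprD -mulnSr prednK.
Qed.

(* Overestimates the cells meeting the shell rho <= boxgauge <= rho + eta: it only
   uses the bounds of cell_boxgauge. *)
Definition hits a (rho eta : K) Q :=
  (gauge a Q - len Q / 2 <= rho + eta) && (rho <= gauge a Q + len Q).

(** Averaging over [size P] shells of width [eta]. A cell hits at most [2 + 3 / 2 * len Q / eta] of
    them; with as many shells as cells, the rounding term 2 averages to 2. *)
Lemma exists_light_zone P (n : int) a : (0 < size P)%N ->
  exists rho eta : K, [/\ 0 < eta, 2 ^ n <= rho, rho + eta <= 2 * 2 ^ n &
    (count (hits a rho eta) P)%:R <= 2 + 3 / 2 *
      \sum_(Q <- P | gauge a Q - len Q / 2 <= 2 * 2 ^ n) len Q / 2 ^ n].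
Proof.
move=> P0; set s := (2 : K) ^ n; have s0 : 0 < s by rewrite exprz_gt0.
set S := \sum_(_ <- _ | _) _.
pose N := size P; pose eta := s / N%:R.
have N0 : 0 < (N%:R : K) by rewrite ltr0n.
have e0 : 0 < eta by rewrite divr_gt0.
have eN : eta * N%:R = s by rewrite /eta mulfVK ?gt_eqF.
pose rho (j : 'I_N) := s + eta * (j : nat)%:R.
have rhoP j : s <= rho j /\ rho j + eta <= 2 * s.
  rewrite /rho; split; first by rewrite lerDl mulr_ge0// ltW.
  have : ((j : nat)%:R + 1 : K) <= N%:R by rewrite natr1 ler_nat.
  by move=> jN; nra.
have [j jP] : exists j : 'I_N, (count (hits a (rho j) eta) P)%:R <= 2 + 3 / 2 * S.
  apply: (exists_le_average _ _ (fun j => (count (hits a (rho j) eta) P)%:R)) => //.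
  under eq_bigr do rewrite natr_count.
  rewrite exchange_big /=.
  have -> : N%:R * (2 + 3 / 2 * S) = \sum_(Q <- P) 2 +
      \sum_(Q <- P | gauge a Q - len Q / 2 <= 2 * s) 3 / 2 * len Q / eta.
    rewrite big_const_seq count_predT iter_addr_0 -[X in _ = X + _]mulr_natl -/N mulrDr; congr (_ + _).
    rewrite /S !mulr_sumr; apply: eq_bigr => Q _.
    by rewrite -/s -eN; field; rewrite !gt_eqF.
  rewrite [X in _ + X]big_mkcond -big_split /=.
  apply: ler_sum => Q _; have l0 := len_gt0 K m Q.
  case: ifPn => [rel|nrel]; last first.
    rewrite big1 ?addr0// => j _; rewrite /hits.
    have [_ h] := rhoP j; rewrite -ltNge in nrel.
    by have -> : gauge a Q - len Q / 2 <= rho j + eta = false by rewrite leNgt (le_lt_trans h).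
  set w := 3 / 2 * len Q / eta.
  have w0 : 0 <= w by rewrite /w divr_ge0 ?mulr_ge0// ltW.
  (* The two inequalities in [hits] confine [j] to a window of length [w + 1], hence to at most
     [w + 2] values. *)
  have := card_ord_window K N ((gauge a Q - len Q / 2 - s) / eta - 1) (w + 1).
  rewrite addr_ge0// => /(_ isT) cw.
  apply: (@le_trans _ _ (w + 1 + 1)); last by lra.
  apply: le_trans cw; rewrite -natr_sum ler_nat -sum1_card [leqRHS]big_mkcond /=.
  apply: leq_sum => j _; rewrite /hits /rho inE.
  case: andP => // -[h1 h2]; rewrite ifT//.
  rewrite lerBlDr ler_pdivrMr//.
  rewrite [X in _ && (_ <= X)](_ : _ = (gauge a Q + len Q - s) / eta); last first.
    by rewrite /w; field; rewrite gt_eqF.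
  by rewrite ler_pdivlMr//; apply/andP; split; lra.
by exists (rho j), eta; have [] := rhoP j.
Qed.

End separator.

(** * Recursive construction of the sweepout function *)

Section sweepout.
Context (K : realType) (m : nat).
Implicit Types (P : seq (cell m)) (Q : cell m) (a x : 'I_m -> K) (y c : K)
  (h : ('I_m -> K) -> K -> K).
Local Notation len := (cell_len K m).
Local Notation corner := (corner K m).
Local Notation gauge := (gauge K m).
Local Notation boxgauge := (boxgauge K m).
Local Notation hits := (hits K m).

(** Largest proportion of cells left on one side of a separator. Boxes holding less than [4 ^- m.+1]
    of the cells hold at most a quarter when there are [4 ^ m] of them. *)
Definition shrink : K := 1 - (4 ^+ m.+1)^-1.

Lemma shrink_itv : 0 < shrink < 1.
Proof.
rewrite /shrink subr_gt0 gtrBl invr_gt0 exprn_gt0// andbT.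
by rewrite invf_lt1 ?exprn_gt0// exprn_egt1// ltr1n.
Qed.

(** From this size on, the large cells of [count_double_box] make up at most a quarter of [P]. *)
Definition small_size : nat := 8 * (4 * m.+1 + 1) ^ m.

(** Inner cells lie in the doubled box, which holds at most a quarter plus a quarter of [P]. Outer
    cells miss the heavy box, which holds a proportion [1 - shrink]. *)
Lemma exists_separator P (I : nat) : (0 < m)%N -> uniq P ->
  (small_size <= size P)%N ->
  exists a (rho eta : K), [/\ 0 < eta,
    (count (hits a rho eta) P)%:R <= (2 : K) + 6 *
      ((2 * m + 3)%:R ^+ m * (\sum_(i < I.+1) 2 ^+ (i * m.-1)) +
       (size P)%:R / 2 ^+ I),
    (count (fun Q => gauge a Q + len Q < rho)%R P)%:R <= shrink * (size P)%:R &
    (count (fun Q => rho + eta < gauge a Q - len Q / 2)%R P)%:R <=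
      shrink * (size P)%:R].
Proof.
move=> m0 uP NP.
have P0 : (0 < size P)%N by apply: leq_trans NP; rewrite muln_gt0 expn_gt0 addn1.
pose del : K := (4 ^+ m.+1)^-1.
have f0 : 0 < (4 : K) ^+ m by rewrite exprn_gt0.
have d4 : 4 ^+ m * del = 1 / 4 by rewrite /del exprS; field; rewrite gt_eqF.
have d0 : 0 < del by rewrite invr_gt0 exprn_gt0.
have dle : del <= 1 / 4.
  have : 1 <= (4 : K) ^+ m by apply: exprn_ege1; rewrite ler1n.
  by nra.
have d01 : 0 < del <= 1 by apply/andP; split; lra.
have [n [a [aP bP]]] := exists_heavy_box K m P del d01 P0.
have [rho [eta [e0 rho1 rho2 hrho]]] := exists_light_zone K m P n a P0.
have N0 : 0 <= ((size P)%:R : K) by [].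
exists a, rho, eta; split=> //.
- have := relevant_sum K m P n a I m0 uP; lra.
- have := count_double_box K m P n a _ uP (fun b => ltW (bP b)).
  rewrite mulrA d4; set D := (count _ P)%:R => hD.
  have hN : 8 * (4 * m.+1 + 1)%:R ^+ m <= ((size P)%:R : K).
    by rewrite -natrX -natrM ler_nat.
  apply: (@le_trans _ _ D).
    rewrite ler_nat; apply: sub_count => Q /= hQ.
    have := len_gt0 K m Q; lra.
  by rewrite /shrink -/del; nra.
- have /le_trans : ((count (fun Q => rho + eta < gauge a Q - len Q / 2) P)%:R : K) <=
      (count (predC (fun Q => gauge a Q <= 2 ^ n)%R) P)%:R.
    rewrite ler_nat; apply: sub_count => Q /= hQ.
    by rewrite -ltNge; have := len_gt0 K m Q; lra.
  apply; have := count_predC (fun Q => gauge a Q <= 2 ^ n)%R P.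
  move=> /(congr1 (fun k => k%:R : K)); rewrite natrD => hC.
  by rewrite /shrink -/del; lra.
Qed.

Definition crosses h c Q : bool :=
  `[< exists x y, in_cell K m Q x y /\ h x y = c >].

(** The range [0, 1] is what allows gluing with disjoint ranges. Lipschitz refers to the sup norm of
    half-space coordinates, not to the hyperbolic distance. *)
Definition bounded_lipschitz h : Prop :=
  (forall x y, 0 <= h x y <= 1) /\
  exists2 L : K, 0 <= L & forall x y x' y' (D : K),
    `|y - y'| <= D -> (forall i, `|x i - x' i| <= D) ->
    `|h x y - h x' y'| <= L * D.

Definition ramp (rho eta t : K) : K := Num.max 0 (Num.min 1 ((t - rho) / eta)).

Lemma ramp_itv (rho eta t : K) : 0 <= ramp rho eta t <= 1.
Proof. by rewrite /ramp le_max lexx /= ge_max ler01 ge_min lexx. Qed.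

Lemma ramp_low (rho eta t : K) : 0 < eta -> t <= rho -> ramp rho eta t = 0.
Proof.
move=> e0 tr; apply/max_idPl; rewrite ge_min ler_pdivrMr// mul0r subr_le0 tr.
by rewrite orbT.
Qed.

Lemma ramp_high (rho eta t : K) : 0 < eta -> rho + eta <= t -> ramp rho eta t = 1.
Proof.
move=> e0 tr; rewrite /ramp; have /min_idPl -> : 1 <= (t - rho) / eta.
  by rewrite ler_pdivlMr//; lra.
by apply/max_idPr.
Qed.

Lemma ramp_lipschitz (rho eta t t' : K) : 0 < eta ->
  `|ramp rho eta t - ramp rho eta t'| <= `|t - t'| / eta.
Proof.
move=> e0; have -> : `|t - t'| / eta = `|(t - rho) / eta - (t' - rho) / eta|.
  have -> : (t - rho) / eta - (t' - rho) / eta = (t - t') / eta.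
    by rewrite -mulrBl; congr (_ / _); ring.
  by rewrite normrM [`|eta^-1|]gtr0_norm// invr_gt0.
rewrite /ramp; set u := _ / eta; set v := _ / eta.
rewrite /Num.max /Num.min.
case: (ltP 1 u) => h1; case: (ltP 1 v) => h2; rewrite ?ltr01;
  try (case: (ltP 0 u) => h3); try (case: (ltP 0 v) => h4);
  rewrite ler_norml; apply/andP; split; case: (ger0P (u - v)) => h5; lra.
Qed.

(* h1 / 5 inside and (h2 + 4) / 5 outside have disjoint ranges, so a level set of
   glue leaves the shell on one side only. *)
Definition glue a (rho eta : K) h1 h2 x y : K :=
  (h1 x y + ramp rho eta (boxgauge a x y) * (h2 x y + 4 - h1 x y)) / 5.

Lemma glue_bounded_lipschitz a (rho eta : K) h1 h2 : 0 < eta ->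
  bounded_lipschitz h1 -> bounded_lipschitz h2 ->
  bounded_lipschitz (glue a rho eta h1 h2).
Proof.
move=> e0 [b1 [L1 L10 l1]] [b2 [L2 L20 l2]]; split=> [x y|].
  have /andP[p1 p2] := b1 x y; have /andP[q1 q2] := b2 x y.
  have /andP[t1 t2] := ramp_itv rho eta (boxgauge a x y).
  rewrite /glue; set t := ramp _ _ _ in t1 t2 *; set u := h1 x y in p1 p2 *.
  by set v := h2 x y in q1 q2 *; apply/andP; split; nra.
exists (2 * L1 + L2 + eta^-1 * 5); first by rewrite !addr_ge0 ?mulr_ge0// invr_ge0 ltW.
move=> x y x' y' D yD xD.
have D0 : 0 <= D by apply: le_trans yD.
have gD : `|boxgauge a x y - boxgauge a x' y'| <= D.
  have := boxgauge_shift K m a x x' y y' D.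
  have := boxgauge_shift K m a x' x y' y D.
  move: (yD); rewrite !ler_norml => /andP[h1' h2'] s1 s2.
  apply/andP; split.
    rewrite lerBrDl -lerBrDr opprK; apply: s1; first by lra.
    by move=> i; rewrite distrC.
  by rewrite lerBlDl s2//; lra.
have tD : `|ramp rho eta (boxgauge a x y) - ramp rho eta (boxgauge a x' y')| <= eta^-1 * D.
  apply: (le_trans (ramp_lipschitz _ _ _ _ e0)).
  by rewrite mulrC ler_pM2l// invr_gt0.
have := l1 _ _ _ _ _ yD xD; have := l2 _ _ _ _ _ yD xD.
have /andP[p1 p2] := b1 x' y'; have /andP[q1 q2] := b2 x' y'.
have /andP[t1 t2] := ramp_itv rho eta (boxgauge a x y).
rewrite /glue; move: tD.
set t := ramp _ _ _ in t1 t2 *; set t' := ramp _ _ _.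
set u := h1 x y; set v := h2 x y; set u' := h1 x' y' in p1 p2 *.
set v' := h2 x' y' in q1 q2 *.
(* Product rule for differences: [t] lies in [0, 1] and [v' + 4 - u'] in [3, 5], so each term is
   controlled by one Lipschitz constant. *)
have -> : (u + t * (v + 4 - u)) / 5 - (u' + t' * (v' + 4 - u')) / 5 =
  ((u - u') + t * (v - v') + t * (u' - u) + (t - t') * (v' + 4 - u')) / 5 by field.
move: (u - u') (v - v') (t - t') (opprB u u') => du dv dt <-.
have E0 : 0 <= eta^-1 by rewrite invr_ge0 ltW.
move: (eta^-1) E0 => E E0.
have ED : 0 <= E * D by rewrite mulr_ge0.
have LD1 : 0 <= L1 * D by rewrite mulr_ge0.
have LD2 : 0 <= L2 * D by rewrite mulr_ge0.
move=> hdt hdv hdu.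
have N1 : `|t * dv| <= L2 * D.
  rewrite normrM ger0_norm//; apply: le_trans hdv.
  by rewrite ler_piMl.
have N2 : `|t * - du| <= L1 * D.
  rewrite normrM normrN ger0_norm//; apply: le_trans hdu.
  by rewrite ler_piMl.
have N3 : `|dt * (v' + 4 - u')| <= E * D * 5.
  rewrite normrM; apply: ler_pM => //; rewrite ler_norml.
  by apply/andP; split; lra.
move: N1 N2 N3 hdu; rewrite !ler_norml.
move=> /andP[? ?] /andP[? ?] /andP[? ?] /andP[? ?].
by apply/andP; split; lra.
Qed.

(** A cell failing [hits] lies wholly where the ramp is 0, forcing [c <= 1 / 5], or wholly where it
    is 1, forcing [4 / 5 <= c]. Only one side contributes, so [B] is added once. *)
Lemma count_crosses_glue P a (rho eta B : K) h1 h2 : (0 < m)%N -> 0 < eta ->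
  bounded_lipschitz h1 -> bounded_lipschitz h2 ->
  (forall c, (count (crosses h1 c)
    [seq Q <- P | gauge a Q + len Q < rho])%:R <= B) ->
  (forall c, (count (crosses h2 c)
    [seq Q <- P | rho + eta < gauge a Q - len Q / 2])%:R <= B) ->
  forall c, (count (crosses (glue a rho eta h1 h2) c) P)%:R <=
    (count (hits a rho eta) P)%:R + B.
Proof.
move=> m0 e0 [b1 _] [b2 _] B1 B2 c.
have low Q : gauge a Q + len Q < rho -> crosses (glue a rho eta h1 h2) c Q ->
    crosses h1 (5 * c) Q /\ c <= 1 / 5.
  move=> hQ /asboolP[x [y [xyQ]]].
  have /andP[_ g] := cell_boxgauge K m a Q x y m0 xyQ.
  rewrite /glue ramp_low//; last by rewrite (le_trans g)// ltW.
  have /andP[_ h] := b1 x y; rewrite mul0r addr0 => <-; split; last by lra.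
  by apply/asboolP; exists x, y; split=> //; field.
have high Q : rho + eta < gauge a Q - len Q / 2 ->
    crosses (glue a rho eta h1 h2) c Q -> crosses h2 (5 * c - 4) Q /\ 4 / 5 <= c.
  move=> hQ /asboolP[x [y [xyQ]]].
  have /andP[g _] := cell_boxgauge K m a Q x y m0 xyQ.
  rewrite /glue ramp_high//; last by rewrite (le_trans _ g)// ltW.
  have /andP[h _] := b2 x y; rewrite mul1r => <-; split; last by lra.
  by apply/asboolP; exists x, y; split=> //; field.
have [c1|c1] := leP c (1 / 5).
  apply: le_trans (lerD (lexx _) (B1 (5 * c))).
  rewrite -natrD ler_nat count_filter -count_predUI.
  apply: leq_trans (leq_addr _ _); apply: sub_count => Q /= cQ.
  rewrite /hits; have [_|hr] := leP rho (gauge a Q + len Q).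
    rewrite andbT; case: leP => //= hl.
    by have [_] := high _ hl cQ; lra.
  by have [-> _] := low _ hr cQ; rewrite orbT.
apply: le_trans (lerD (lexx _) (B2 (5 * c - 4))).
rewrite -natrD ler_nat count_filter -count_predUI.
apply: leq_trans (leq_addr _ _); apply: sub_count => Q /= cQ.
rewrite /hits; case: leP => /= hl.
  have [//|hr] := leP rho (gauge a Q + len Q).
  by have [_] := low _ hr cQ; lra.
by have [-> _] := high _ hl cQ.
Qed.

(* S bounds the cost of one separator, F the total cost of the recursion. *)
Theorem exists_sweepout (F S : nat -> K) (C theta : K) : (0 < m)%N ->
  0 < theta -> 0 <= C -> (forall n, 0 <= F n) ->
  (forall N, (0 < N)%N -> exists I : nat,
    \sum_(i < I.+1) 2 ^+ (i * m.-1) + N%:R / 2 ^+ I + 1 <= C * S N) ->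
  (forall n N, (0 < N)%N -> n%:R <= shrink * N%:R -> F n + theta * S N <= F N) ->
  exists2 A : K, 0 <= A & forall P, uniq P -> exists2 h, bounded_lipschitz h &
    forall c, (count (crosses h c) P)%:R <= A * F (size P) + small_size%:R.
Proof.
move=> m0 t0 C0 F0 FS FF.
pose k : K := (2 * m + 3)%:R ^+ m.
have k1 : 1 <= k by apply: exprn_ege1; rewrite ler1n addn_gt0 orbT.
(* Chosen so that the gain [A * theta * S N] of the recursion equals the separator cost
   [6 * k * C * S N]. *)
pose A := 6 * k * C / theta.
have A0 : 0 <= A by rewrite /A divr_ge0 ?mulr_ge0 ?(ltW t0)//; lra.
exists A => // P; have [N] := ubnP (size P); elim: N P => // N IH P PN uP.
have [small|big] := leqP (size P) small_size.
  exists (fun _ _ => 0).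
    split=> [x y|]; first by rewrite lexx ler01.
    by exists 0 => // *; rewrite subrr normr0 mul0r.
  move=> c; apply: (@le_trans _ _ small_size%:R).
    by rewrite ler_nat (leq_trans (count_size _ _)).
  by rewrite lerDr mulr_ge0.
have P0 : (0 < size P)%N by apply: leq_ltn_trans big.
have [I II] := FS _ P0.
have [a [rho [eta [e0 hitP lowP highP]]]] := exists_separator P I m0 uP (ltnW big).
have sh1 : shrink < 1 by rewrite /shrink gtrBl invr_gt0 exprn_gt0.
have sz (p : pred (cell m)) : (count p P)%:R <= shrink * (size P)%:R ->
    (size [seq Q <- P | p Q] < N)%N.
  move=> hp; rewrite -ltnS; apply: leq_trans PN; rewrite ltnS size_filter -(ltr_nat K).
  by apply: (le_lt_trans hp); rewrite gtr_pMl// ltr0n.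
pose B := A * (F (size P) - theta * S (size P)) + small_size%:R.
have sweep (p : pred (cell m)) : (count p P)%:R <= shrink * (size P)%:R ->
    exists2 h, bounded_lipschitz h &
      forall c, (count (crosses h c) [seq Q <- P | p Q])%:R <= B.
  move=> hp; have [h hL hP] := IH _ (sz _ hp) (filter_uniq _ uP).
  exists h => // c; apply: (le_trans (hP c)); rewrite lerD2r ler_wpM2l// lerBrDr.
  by apply: FF => //; rewrite size_filter.
have [h1 L1 B1] := sweep _ lowP; have [h2 L2 B2] := sweep _ highP.
exists (glue a rho eta h1 h2); first exact: glue_bounded_lipschitz.
move=> c; have := count_crosses_glue P a rho eta B h1 h2 m0 e0 L1 L2 B1 B2 c.
move=> /le_trans; apply.
have -> : A * F (size P) + small_size%:R = 6 * k * C * S (size P) + B.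
  by rewrite /B /A; field; rewrite gt_eqF.
rewrite lerD2r; apply: (le_trans hitP); rewrite -/k -!mulrA [X in _ <= _ * X]mulrA.
(* Since [k >= 1], [2 + 6 * (k * X + Y) <= 6 * k * (X + Y + 1)]. *)
move: II; set X := \sum_(i < _) _; set Y := _ / 2 ^+ I => II.
have X0 : 0 <= X by apply: sumr_ge0 => i _; rewrite exprn_ge0.
have Y0 : 0 <= Y by rewrite divr_ge0// exprn_ge0.
by nra.
Qed.

End sweepout.

(** * Growth rates that close the recursion *)

Section growth.
Context (K : realType) (m : nat).
Local Notation shrink := (shrink K m).

Lemma trunc_log_itv (p N : nat) : (1 < p)%N -> (0 < N)%N ->
  p%:R ^+ trunc_log p N <= (N%:R : K) < p%:R ^+ (trunc_log p N).+1.
Proof.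
by move=> p1 N0; rewrite -!natrX ler_nat ltr_nat trunc_logP// trunc_log_ltn.
Qed.

(** The ratio [2 ^ m.-1] is at least 2, so the last term dominates. *)
Lemma geometric_le (I : nat) : (1 < m)%N ->
  \sum_(i < I.+1) (2 : K) ^+ (i * m.-1) <= 2 * 2 ^+ (I * m.-1).
Proof.
move=> m1; elim: I => [|I IH].
  by rewrite big_ord_recr big_ord0 /= mul0n expr0; lra.
rewrite big_ord_recr /=.
have : 2 * (2 : K) ^+ (I * m.-1) <= 2 ^+ (I.+1 * m.-1).
  by rewrite -exprS ler_eXn2l ?ltr1n// mulSn -add1n leq_add2r; lia.
lra.
Qed.

(** Taking [2 ^ (m * I)] comparable to [N] balances the volume count against the tail: both have
    order [2 ^ (I * m.-1)]. *)
Lemma power_separator_sum : (1 < m)%N -> exists2 C : K, 0 <= C &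
  forall N, (0 < N)%N -> exists I : nat,
    \sum_(i < I.+1) 2 ^+ (i * m.-1) + N%:R / 2 ^+ I + 1 <=
      C * N%:R `^ (1 - m%:R^-1).
Proof.
move=> m1; exists (3 + 2 ^+ m); first by rewrite addr_ge0 ?exprn_ge0.
move=> N N0; pose I := trunc_log (2 ^ m) N; exists I.
have p1 : (1 < 2 ^ m)%N by rewrite -[X in (X < _)%N](expn0 2) ltn_exp2l//; lia.
have /andP[] := trunc_log_itv _ _ p1 N0; rewrite -/I natrX => lo hi.
have m0 : (m%:R : K) != 0 by rewrite pnatr_eq0; lia.
set E : K := 2 ^+ (I * m.-1).
have E1 : 1 <= E by apply: exprn_ege1; rewrite ler1n.
have EN : E <= N%:R `^ (1 - m%:R^-1).
  have -> : E = ((2 ^+ m) ^+ I) `^ (1 - m%:R^-1).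
    rewrite -!exprM /E -!powR_mulrn// -powRrM; congr (_ `^ _).
    rewrite natrM natrM -subn1 natrB; last by lia.
    by field.
  apply: ge0_ler_powR; rewrite ?nnegrE ?exprn_ge0//.
  by rewrite subr_ge0 invf_le1 ?ltr0n ?ler1n; lia.
have hE : N%:R / 2 ^+ I <= 2 ^+ m * E.
  rewrite ler_pdivrMr ?exprn_gt0//; apply: (le_trans (ltW hi)).
  rewrite -!exprM -!exprD ler_eXn2l ?ltr1n//.
  rewrite mulnS -addnA leq_add2l -mulnSr prednK; last by lia.
  by rewrite mulnC.
apply: (@le_trans _ _ ((3 + 2 ^+ m) * E)).
  by have := geometric_le I m1; rewrite -/E; lra.
by rewrite ler_wpM2l// addr_ge0 ?exprn_ge0.
Qed.

Lemma power_contraction (al : K) : 0 < al -> exists2 theta : K, 0 < theta &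
  forall n N : nat, (0 < N)%N -> n%:R <= shrink * N%:R ->
    n%:R `^ al + theta * N%:R `^ al <= N%:R `^ al.
Proof.
move=> al0; have /andP[s0 s1] := shrink_itv K m; exists (1 - shrink `^ al).
  rewrite subr_gt0 -[ltRHS](congr1 (@^~ al) (powR1 K)).
  by apply: gt0_ltr_powR; rewrite ?nnegrE// ltW.
move=> n N _ nN.
have : n%:R `^ al <= (shrink * N%:R) `^ al.
  by apply: ge0_ler_powR; rewrite ?nnegrE ?(ltW al0)// mulr_ge0// ltW.
rewrite powRM ?(ltW s0)//; lra.
Qed.

(** Every dyadic level now contributes 1; with [2 ^ I] comparable to [N] the total is at most
    [I + 4]. *)
Lemma log_separator_sum : m = 1%N -> exists2 C : K, 0 <= C &
  forall N, (0 < N)%N -> exists I : nat,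
    \sum_(i < I.+1) 2 ^+ (i * m.-1) + N%:R / 2 ^+ I + 1 <= C * ln (1 + N%:R).
Proof.
move=> ->; have l2 : 0 < ln (2 : K) by rewrite ln_gt0// ltr1n.
exists (5 / ln 2); first by rewrite divr_ge0// ltW.
move=> N N0; pose I := trunc_log 2 N; exists I.
have /andP[] := trunc_log_itv 2 N isT N0; rewrite -/I => lo hi.
under eq_bigr do rewrite muln0 expr0.
rewrite sumr_const card_ord.
have p0 : 0 < (2 : K) ^+ I by rewrite exprn_gt0.
have h1 : N%:R / 2 ^+ I <= (2 : K) by rewrite ler_pdivrMr// -exprS ltW.
have N1 : 1 <= (N%:R : K) by rewrite ler1n.
have h2 : ln 2 <= ln (1 + N%:R : K) by rewrite ler_ln ?posrE//; lra.
have h3 : I%:R * ln 2 <= ln (1 + N%:R : K).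
  rewrite mulr_natl -lnXn// ler_ln ?posrE//; lra.
apply: (@le_trans _ _ (I%:R + 4)); first by rewrite -natr1; lra.
rewrite mulrAC ler_pdivlMr//; lra.
Qed.

(** Shrinking [N] lowers the logarithm by a fixed amount, hence its square by a multiple of the
    logarithm. *)
Lemma log_contraction : exists2 theta : K, 0 < theta &
  forall n N : nat, (0 < N)%N -> n%:R <= shrink * N%:R ->
    ln (1 + n%:R) ^+ 2 + theta * ln (1 + N%:R) <= ln (1 + N%:R) ^+ 2.
Proof.
(* The midpoint absorbs the shift by 1: [1 + shrink * N <= t * (1 + N)] once [N >= 1]. *)
have /andP[s0 s1] := shrink_itv K m; pose t := (1 + shrink) / 2.
have t0 : 0 < t by rewrite /t; lra.
exists (- ln t); first by rewrite oppr_gt0 ln_lt0// t0 /t /=; lra.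
move=> n N N0 nN; have N1 : 1 <= (N%:R : K) by rewrite ler1n.
have n0 : 0 <= (n%:R : K) by [].
have : ln (1 + n%:R) <= ln t + ln (1 + N%:R).
  have N2 : 0 < 1 + N%:R :> K by lra.
  have n2 : 0 < 1 + n%:R :> K by lra.
  rewrite -lnM ?posrE// ler_ln ?posrE ?(mulr_gt0 t0 N2)//.
  by rewrite /t; nra.
have u0 : 0 <= ln (1 + n%:R : K) by rewrite ln_ge0//; lra.
have T0 : ln t <= 0 by rewrite ln_le0// /t; lra.
move: u0 T0; move: (ln t) (ln (1 + n%:R : K)) (ln (1 + N%:R : K)) => T u L; nra.
Qed.

End growth.

(** * From the hyperboloid to the upper half-space *)

Section halfspace.
Context (k : nat).
Implicit Types (p : R * 'rV[R]_k.+1) (x : 'I_k -> R) (y : R).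

(** Inverse of the Lorentz product with the lightlike vector [(1, e_0)], the ideal point sent to
    infinity. *)
Definition hgt p : R := (p.1 - p.2 0 ord0)^-1.

Definition hor p (i : 'I_k) : R := p.2 0 (lift ord0 i) * hgt p.

(* Inverse of the chart (hor, hgt). *)
Definition hpoint x y : R * 'rV[R]_k.+1 :=
  let w := y + (\sum_i x i ^+ 2) / y in
  ((w + y^-1) / 2,
   \row_i if unlift ord0 i is Some j then x j / y else (w - y^-1) / 2).

Lemma Hyp_lightlike_gt0 p : Hyp k.+1 p -> 0 < p.1 - p.2 0 ord0.
Proof.
case: p => t v [/= t0]; rewrite /lor /= big_ord_recl.
have : 0 <= \sum_(i < k) v 0 (lift ord0 i) * v 0 (lift ord0 i).
  by apply: sumr_ge0 => i _; rewrite -expr2 sqr_ge0.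
set S := \sum_(i < k) _; move: (v 0 ord0) => v0 S0 e.
by have [|//] := lerP (t - v0) 0; nra.
Qed.

Lemma hgt_gt0 p : Hyp k.+1 p -> 0 < hgt p.
Proof. by move=> /Hyp_lightlike_gt0; rewrite invr_gt0. Qed.

(** The classical half-space formula for the hyperbolic cosine of the distance. The hyperboloid
    equations eliminate the squared norms [A] and [A']. *)
Lemma lor_halfspace p p' : Hyp k.+1 p -> Hyp k.+1 p' ->
  lor k.+1 p p' = 1 + (\sum_i (hor p i - hor p' i) ^+ 2 + (hgt p - hgt p') ^+ 2)
                      / (2 * hgt p * hgt p').
Proof.
move=> Hp Hp'; have := Hyp_lightlike_gt0 _ Hp; have := Hyp_lightlike_gt0 _ Hp'.
have -> : \sum_i (hor p i - hor p' i) ^+ 2 =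
    (\sum_i p.2 0 (lift ord0 i) * p.2 0 (lift ord0 i)) * hgt p ^+ 2 +
    (\sum_i p'.2 0 (lift ord0 i) * p'.2 0 (lift ord0 i)) * hgt p' ^+ 2 -
    (\sum_i p.2 0 (lift ord0 i) * p'.2 0 (lift ord0 i)) * (2 * hgt p * hgt p').
  rewrite !mulr_suml -big_split /= -sumrB; apply: eq_bigr => i _.
  by rewrite /hor; ring.
move: Hp Hp' => [_] + [_]; rewrite /lor /hgt !big_ord_recl.
set A := \sum_i p.2 0 _ * p.2 0 _; set A' := \sum_i p'.2 0 _ * p'.2 0 _.
set B := \sum_i _.
move: (p.1) (p.2 0 ord0) (p'.1) (p'.2 0 ord0) => t v t' v' e e' u' u.
have -> : A = (t - v) * (t + v) - 1 by lra.
have -> : A' = (t' - v') * (t' + v') - 1 by lra.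
by field; rewrite !gt_eqF.
Qed.

Lemma lor_ge1 p p' : Hyp k.+1 p -> Hyp k.+1 p' -> 1 <= lor k.+1 p p'.
Proof.
move=> Hp Hp'; rewrite lor_halfspace// lerDl divr_ge0//.
  by rewrite addr_ge0 ?sqr_ge0// sumr_ge0// => i _; rewrite sqr_ge0.
by rewrite !mulr_ge0// ltW// hgt_gt0.
Qed.

Lemma hpoint_lightlike x y : (hpoint x y).1 - (hpoint x y).2 0 ord0 = y^-1.
Proof. by rewrite /hpoint /= mxE unlift_none; lra. Qed.

Lemma hgt_hpoint x y : hgt (hpoint x y) = y.
Proof. by rewrite /hgt hpoint_lightlike invrK. Qed.

Lemma hor_hpoint x y i : y != 0 -> hor (hpoint x y) i = x i.
Proof. by move=> y0; rewrite /hor hgt_hpoint /hpoint /= mxE liftK mulfVK. Qed.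

Lemma Hyp_hpoint x y : 0 < y -> Hyp k.+1 (hpoint x y).
Proof.
move=> y0; have S0 : 0 <= \sum_i x i ^+ 2 by apply: sumr_ge0 => i _; rewrite sqr_ge0.
split; rewrite /lor /hpoint /=.
  by rewrite divr_gt0// addr_gt0 ?invr_gt0// ltr_wpDr ?divr_ge0 ?(ltW y0).
rewrite big_ord_recl mxE unlift_none.
have -> : \sum_(i < k) (\row_i (if unlift ord0 i is Some j then x j / y
    else (y + (\sum_i x i ^+ 2) / y - y^-1) / 2)) 0 (lift ord0 i) *
   (\row_i (if unlift ord0 i is Some j then x j / y
    else (y + (\sum_i x i ^+ 2) / y - y^-1) / 2)) 0 (lift ord0 i) =
   (\sum_i x i ^+ 2) / y ^+ 2.
  rewrite [RHS]mulr_suml; apply: eq_bigr => i _; rewrite mxE liftK.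
  by field; rewrite gt_eqF.
by field; rewrite gt_eqF.
Qed.

(** The square root is at most 3/4, so the logarithm is taken of at most 2. *)
Lemma hdist_le1 p p' : Hyp k.+1 p -> Hyp k.+1 p' ->
  lor k.+1 p p' <= 5 / 4 -> hdist k.+1 p p' <= 1.
Proof.
move=> Hp Hp' h; have l1 := lor_ge1 _ _ Hp Hp'.
have s0 := sqrtr_ge0 (lor k.+1 p p' ^+ 2 - 1).
have s1 : Num.sqrt (lor k.+1 p p' ^+ 2 - 1) <= 3 / 4.
  rewrite -(@ger0_norm _ (3 / 4 : R))// -sqrtr_sqr ler_wsqrtr//; nra.
rewrite /hdist; set z := _ + _.
have -> : z = 1 + (z - 1) by ring.
by apply: (le_trans (le_ln1Dx _)); rewrite /z; lra.
Qed.

Lemma lor_lt_expR p p' (t : R) : Hyp k.+1 p -> Hyp k.+1 p' ->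
  hdist k.+1 p p' < t -> lor k.+1 p p' < expR t.
Proof.
move=> Hp Hp' h; have l1 := lor_ge1 _ _ Hp Hp'.
have s0 := sqrtr_ge0 (lor k.+1 p p' ^+ 2 - 1).
apply: (@le_lt_trans _ _ (lor k.+1 p p' + Num.sqrt (lor k.+1 p p' ^+ 2 - 1))); first by lra.
by rewrite -[ltLHS]lnK ?ltr_expR// posrE; lra.
Qed.

Lemma sqr_diff_halfspace p p' : Hyp k.+1 p -> Hyp k.+1 p' ->
  (forall i, (hor p i - hor p' i) ^+ 2 <=
     2 * hgt p * hgt p' * (lor k.+1 p p' - 1)) /\
  (hgt p - hgt p') ^+ 2 <= 2 * hgt p * hgt p' * (lor k.+1 p p' - 1).
Proof.
move=> Hp Hp'; have y0 := hgt_gt0 _ Hp; have y0' := hgt_gt0 _ Hp'.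
have -> : 2 * hgt p * hgt p' * (lor k.+1 p p' - 1) =
    \sum_i (hor p i - hor p' i) ^+ 2 + (hgt p - hgt p') ^+ 2.
  by rewrite lor_halfspace//; field; rewrite !gt_eqF.
split; last by rewrite lerDr sumr_ge0// => i _; rewrite sqr_ge0.
move=> i; rewrite (bigD1 i)//= -addrA lerDl addr_ge0 ?sqr_ge0//.
by rewrite sumr_ge0// => j _; rewrite sqr_ge0.
Qed.

Lemma hgt_le8 p p' : Hyp k.+1 p -> Hyp k.+1 p' -> lor k.+1 p p' <= 4 ->
  hgt p' <= 8 * hgt p.
Proof.
move=> Hp Hp' h; have y0 := hgt_gt0 _ Hp; have y0' := hgt_gt0 _ Hp'.
have l1 := lor_ge1 _ _ Hp Hp'.
have [_] := sqr_diff_halfspace _ _ Hp Hp'.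
have : 0 < hgt p * hgt p' by rewrite mulr_gt0.
move: (lor _ _ _) (hgt p) (hgt p') h l1 y0 y0' => l y y' h l1 y0 y0' yy.
have : y * y' * (l - 1) <= y * y' * 3 by rewrite ler_pM2l//; lra.
by move=> h1 h2; rewrite -(ler_pM2l y0'); nra.
Qed.

(** From [expR (- (1 / 2)) >= 1 / 2], inverted and squared. *)
Lemma expR1_le4 : expR (1 : R) <= 4.
Proof.
have -> : (1 : R) = 2%:R * (1 / 2) by field.
rewrite expRM_natl.
have : 1 / 2 <= expR (- (1 / 2) : R).
  by apply: le_trans (expR_ge1Dx _); lra.
rewrite expRN; have := expR_gt0 (1 / 2 : R); move: (expR _) => e e0.
by rewrite -[1 / 2]invrK lef_pV2 ?posrE// => h; nra.
Qed.

(** Here [lor] is at most [expR 1 <= 4], so squared coordinate differences are at most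
    [6 * hgt p * hgt p' <= 48 * hgt p ^+ 2], below [7 ^ 2 * hgt p ^+ 2]. *)
Lemma hdist_le1_halfspace p p' : Hyp k.+1 p -> Hyp k.+1 p' ->
  hdist k.+1 p p' <= 1 ->
  [/\ hgt p' <= 8 * hgt p, hgt p <= 8 * hgt p' &
      forall i, `|hor p' i - hor p i| <= 7 * hgt p].
Proof.
move=> Hp Hp' h; have y0 := hgt_gt0 _ Hp; have y0' := hgt_gt0 _ Hp'.
have l1 := lor_ge1 _ _ Hp Hp'.
have s0 := sqrtr_ge0 (lor k.+1 p p' ^+ 2 - 1).
have l4 : lor k.+1 p p' <= 4.
  apply: le_trans expR1_le4.
  apply: (@le_trans _ _ (lor k.+1 p p' + Num.sqrt (lor k.+1 p p' ^+ 2 - 1))); first by lra.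
  by rewrite -[leLHS]lnK ?ler_expR// posrE; lra.
have lC : lor k.+1 p' p = lor k.+1 p p'.
  by rewrite /lor mulrC; congr (_ - _); apply: eq_bigr => i _; rewrite mulrC.
have h8 := hgt_le8 _ _ Hp Hp' l4.
split=> // [|i]; first by apply: hgt_le8 => //; rewrite lC.
have [/(_ i) hi _] := sqr_diff_halfspace _ _ Hp Hp'.
rewrite distrC -(ler_pXn2r (_ : 0 < 2)%N) ?nnegrE ?mulr_ge0 ?(ltW y0)//.
rewrite real_normK ?num_real//; apply: (le_trans hi).
have yy : 0 < hgt p * hgt p' by rewrite mulr_gt0.
move: (lor _ _ _) (hgt p) (hgt p') l4 l1 y0 y0' h8 yy => l y y' {}h {}l1 {}y0 {}y0' {}h8 yy.
have : y * y' * (l - 1) <= y * y' * 3 by rewrite ler_pM2l//; lra.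
have : y * y' <= y * (8 * y) by rewrite ler_pM2l.
nra.
Qed.

End halfspace.

(** * Number of cells meeting a unit ball *)

Lemma size_flatten_map_le (T U : Type) (f : T -> seq U) (s : seq T) (M : nat) :
  (forall t, size (f t) <= M)%N -> (size (flatten (map f s)) <= size s * M)%N.
Proof.
by move=> fM; elim: s => [|t s IH] //=; rewrite size_cat mulSn leq_add.
Qed.

(* 7 dyadic levels, and at most 224 * (m + 1) + 2 values of each horizontal index. *)
Definition ball_cell_number (m : nat) : nat := 7 * (224 * m.+1 + 2) ^ m.

Lemma ball_cells (K : realType) (m : nat) (x : 'I_m -> K) (y : K) : 0 < y ->
  exists2 cs : seq (cell m), (size cs <= ball_cell_number m)%N &
    forall x' y' Q, y' <= 8 * y -> y <= 8 * y' ->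
      (forall i, `|x' i - x i| <= 7 * y) -> in_cell K m Q x' y' -> Q \in cs.
Proof.
move=> y0; have [n /andP[n1 n2]] := dyadic_level K y y0.
pose lev (e : 'I_7) : int := n - 3 + (e : nat)%:Z.
have levE (e : 'I_7) : y < 16 * 2 ^ lev e.
  apply: (lt_le_trans n2); apply: (@le_trans _ _ (16 * 2 ^ (n - 3))).
    by rewrite expfzDr// -exprnN; set s := 2 ^ n; lra.
  by rewrite ler_pM2l// ler_eXz2l ?ltr1n// /lev; lia.
have l0 (z : int) : 0 < (2 : K) ^ z by rewrite exprz_gt0.
have m0 : 0 < (m.+1%:R : K) by rewrite ltr0Sn.
(* Indices span [14 * y * m.+1 / 2 ^ lev e], plus 1 because a corner may lie one cell width to the
   left; [levE] and [14 * 16 = 224] give the count. *)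
have wk (e : 'I_7) : 14 * y * m.+1%:R / 2 ^ lev e + 1 < (224 * m.+1 + 2)%:R.
  have : 14 * y * m.+1%:R / 2 ^ lev e <= 224 * m.+1%:R.
    rewrite ler_pdivrMr//; have := levE e; move: (2 ^ lev e) (l0 (lev e)) => l ll h.
    by nra.
  by rewrite natrD natrM; lra.
have /choice[cs csP] := fun e : 'I_7 => (exists2P _ _).1 (cell_window K m (lev e)
  (fun i => m.+1%:R * (x i - 7 * y) / 2 ^ lev e - 1) _ _ (wk e)).
exists (flatten [seq cs e | e <- enum 'I_7]).
  have szcs e : (size (cs e) <= (224 * m.+1 + 2) ^ m)%N by have [-> _] := csP e.
  apply: (leq_trans (size_flatten_map_le _ _ cs _ _ szcs)).
  by rewrite size_enum_ord.
move=> x' y' Q y1 y2 xx [/andP[q1 q2] qx].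
have Qlo : n - 4 < Q.1.
  rewrite -(@ltr_eXz2l K 2) ?ltr1n// expfzDr// -exprnN.
  by move: q2; rewrite /cell_len; set s := 2 ^ n in n1 n2 *; lra.
have Qhi : Q.1 < n + 4.
  rewrite -(@ltr_eXz2l K 2) ?ltr1n// expfzDr//.
  by move: q1; rewrite /cell_len -[X in _ < _ * X]/((2 : K) ^+ 4); set s := 2 ^ n in n1 n2 *; lra.
have e7 : (`|(Q.1 - (n - 3))%R| < 7)%N by lia.
apply/flattenP; exists (cs (Ordinal e7)); first by rewrite map_f// mem_enum.
have [_] := csP (Ordinal e7); set e := Ordinal e7.
have eQ : Q.1 = lev e by rewrite /lev /=; lia.
apply=> // i; have := xx i; rewrite ler_norml => /andP[x1 x2].
have := qx i; rewrite /corner /cell_len eQ; have := l0 (lev e).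
move: (2 ^ lev e) => l ll; rewrite -mulrDl ler_pdivrMr// ler_pdivlMr//.
move=> /andP[c1 c2].
rewrite lerBlDr ler_pdivrMr//.
rewrite [X in _ && (_ <= X)](_ : _ = (m.+1%:R * (x i + 7 * y)) / l); last first.
  by field; rewrite gt_eqF.
by rewrite ler_pdivlMr//; apply/andP; split; nra.
Qed.

(** * Maps to Euclidean space and the bound on their fibres *)

Section upper_bound.
Context (r m : nat).
Local Notation d := (r + m).+1.
Local Notation q := r.+1.

Definition shor (p : R * 'rV[R]_d) (j : 'I_m) : R := hor (r + m) p (rshift r j).

(** Coordinate 0 carries [h] on the projection; the other [r = q - 1] record the dropped horizontal
    coordinates. *)
Definition fibered (h : ('I_m -> R) -> R -> R) (p : R * 'rV[R]_d) : 'rV[R]_q :=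
  \row_i if unlift ord0 i is Some j then hor (r + m) p (lshift m j)
         else h (shor p) (hgt (r + m) p).

Lemma fibered_cont_on h (Z : set (R * 'rV[R]_d)) : bounded_lipschitz R m h ->
  (Z `<=` Hyp d)%classic -> cont_on d q Z (fibered h).
Proof.
move=> [_ [L L0 hL]] ZH p /ZH Hp eps eps0.
have y0 := hgt_gt0 _ _ Hp; set y := hgt _ p in y0.
(* Each half-space coordinate will change by at most [D] with [D ^+ 2 = 16 * y ^+ 2 * e], so [edist]
   squared is at most [T * e]. The cap 3 on [e] keeps [lor] below 4, as [hgt_le8] requires. *)
pose T := q%:R * ((1 + L ^+ 2) * (16 * y ^+ 2)).
have L2 : 0 <= L ^+ 2 by rewrite sqr_ge0.
have T0 : 0 < T by rewrite /T !mulr_gt0 ?exprn_gt0 ?ltr0Sn//; lra.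
pose e := Num.min 3 (eps ^+ 2 / (2 * T)).
have T2 : 0 < 2 * T by lra.
have e0 : 0 < e by rewrite /e lt_min ltr0n /= (divr_gt0 (exprn_gt0 2 eps0) T2).
have e3 : e <= 3 by rewrite /e ge_min lexx.
have eT : T * e < eps ^+ 2.
  apply: (@le_lt_trans _ _ (eps ^+ 2 / 2)); last by have := exprn_gt0 2 eps0; lra.
  have -> : eps ^+ 2 / 2 = T * (eps ^+ 2 / (2 * T)) by field; rewrite gt_eqF.
  by rewrite ler_pM2l// /e ge_min lexx orbT.
exists (ln (1 + e)); first by rewrite ln_gt0//; lra.
move=> p' /ZH Hp' /(lor_lt_expR _ _ _ _ Hp Hp'); rewrite lnK ?posrE; last by lra.
move=> lore; have l1 := lor_ge1 _ _ _ Hp Hp'.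
have l4 : lor d p p' <= 4 by lra.
have y8 := hgt_le8 _ _ _ Hp Hp' l4; have y0' := hgt_gt0 _ _ Hp'.
pose D := Num.sqrt (16 * y ^+ 2 * e).
have DD : D ^+ 2 = 16 * y ^+ 2 * e by rewrite sqr_sqrtr// !mulr_ge0 ?sqr_ge0 ?ltW.
have D0 : 0 <= D := sqrtr_ge0 _.
have [hx hy] := sqr_diff_halfspace _ _ _ Hp Hp'.
have hD : 2 * y * hgt _ p' * (lor d p p' - 1) <= D ^+ 2.
  rewrite DD [leLHS](_ : _ = 2 * (y * hgt _ p' * (lor d p p' - 1))); last by ring.
  rewrite [leRHS](_ : _ = 2 * (y * (8 * y) * e)); last by ring.
  rewrite ler_pM2l//; apply: ler_pM; rewrite ?mulr_ge0 ?(ltW y0) ?(ltW y0')//; try lra.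
  by rewrite ler_pM2l.
have sqD (t : R) : t ^+ 2 <= D ^+ 2 -> `|t| <= D.
  move=> tD; rewrite -(ler_pXn2r (_ : 0 < 2)%N) ?nnegrE//.
  by rewrite real_normK ?num_real.
have hyD : `|y - hgt _ p'| <= D by apply: sqD; apply: le_trans hD.
have hxD i : `|hor _ p i - hor _ p' i| <= D by apply: sqD; apply: le_trans (hx i) hD.
rewrite /edist -[ltRHS](gtr0_norm eps0) -sqrtr_sqr ltr_sqrt ?exprn_gt0//.
apply: le_lt_trans eT.
have -> : T * e = \sum_(i < q) ((1 + L ^+ 2) * D ^+ 2).
  by rewrite sumr_const card_ord -[RHS]mulr_natl DD /T; ring.
apply: ler_sum => i _; rewrite !mxE; case: unliftP => [j _|_].
  apply: (@le_trans _ _ (D ^+ 2)); last by have := sqr_ge0 D; nra.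
  exact: le_trans (hx _) hD.
apply: (@le_trans _ _ ((L * D) ^+ 2)); last by rewrite exprMn; have := sqr_ge0 D; nra.
rewrite -real_normK ?num_real// lerXn2r ?nnegrE ?mulr_ge0//.
by apply: hL => // j; exact: hxD.
Qed.

(** The fibre fixes the dropped coordinates, so its part over one crossed cell fits in one unit
    ball, centred at the corner raised to height 3/2 of the cell length. *)
Lemma fibered_fiber_Cov1 h (Z : set (R * 'rV[R]_d)) (P : seq (cell m)) (B : R)
    (z : 'rV[R]_q) :
  (Z `<=` Hyp d)%classic ->
  (forall p Q, Z p -> in_cell R m Q (shor p) (hgt (r + m) p) -> Q \in P) ->
  (forall c, (count (crosses R m h c) P)%:R <= B) ->
  (Cov1 d [set x | Z x /\ fibered h x = z]%classic <= B%:E)%E.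
Proof.
move=> ZH ZP hB; pose c := z 0 ord0.
pose coord (Q : cell m) (i : 'I_(r + m)) := match fintype.split i with
  | inl j => z 0 (lift ord0 j) | inr j => corner R m Q j end.
pose ctr Q := hpoint (r + m) (coord Q) (3 / 2 * cell_len R m Q).
have l0 Q : 0 < 3 / 2 * cell_len R m Q by rewrite mulr_gt0// len_gt0.
pose cs := [seq ctr Q | Q <- [seq Q <- P | crosses R m h c Q]].
apply: (@le_trans _ _ ((size cs)%:R%:E)%E); last first.
  by rewrite lee_fin size_map size_filter hB.
apply: ereal_inf_lbound; exists (size cs) => //; exists cs; split=> //; split.
  by move=> _ /mapP[Q _ ->]; apply: Hyp_hpoint.
move=> p [Zp fp]; have Hp := ZH _ Zp; have y0 := hgt_gt0 _ _ Hp.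
have [Q pQ] := exists_cell R m (shor p) _ y0.
exists (ctr Q).
  apply: map_f; rewrite mem_filter (ZP p)// andbT; apply/asboolP.
  exists (shor p), (hgt (r + m) p); split=> //.
  by rewrite /c -fp mxE unlift_none.
apply: hdist_le1 => //; first exact: Hyp_hpoint.
rewrite lor_halfspace//; last exact: Hyp_hpoint.
rewrite /ctr hgt_hpoint big_split_ord /= big1; last first.
  move=> j _; rewrite hor_hpoint ?gt_eqF// /coord.
  case: splitP => [j' /= /ord_inj <-|j' /= e]; last first.
    by have := ltn_ord j; rewrite e; lia.
  by rewrite -fp mxE liftK subrr expr0n.
case: pQ => /andP[q1 q2] qx; have len0 := len_gt0 R m Q.
have S : \sum_(j < m) (hor (r + m) (hpoint (r + m) (coord Q) (3 / 2 * cell_len R m Q)) (rshift r j)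
    - hor (r + m) p (rshift r j)) ^+ 2 <= cell_len R m Q ^+ 2 / 4.
  have w0 : 0 < cell_len R m Q / m.+1%:R by rewrite divr_gt0.
  apply: (@le_trans _ _ (\sum_(j < m) (cell_len R m Q / m.+1%:R) ^+ 2)).
    apply: ler_sum => j _; rewrite hor_hpoint ?gt_eqF// /coord.
    case: splitP => [j' e|j' /= /addnI /ord_inj <-].
      by have := ltn_ord j'; rewrite -e /=; lia.
    have /andP[] := qx j; rewrite /shor; move: (hor _ _ _) (corner _ _ _ _) => u v.
    move: (cell_len R m Q / _) w0 => w w0 h1 h2.
    by rewrite -subr_ge0 subr_sqr mulr_ge0//; lra.
  rewrite sumr_const card_ord -[leLHS]mulr_natl expr_div_n mulrCA ler_pM2l ?exprn_gt0//.
  rewrite ler_pdivrMr ?exprn_gt0 ?ltr0Sn// -[m.+1%:R]natr1.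
  by have := sqr_ge0 ((m%:R : R) - 1); nra.
(* Horizontal and vertical parts are each at most [l ^+ 2 / 4], and the denominator is at least
   [3 * l ^+ 2]. *)
suff key (s l y : R) : s <= l ^+ 2 / 4 -> l <= y -> y < 2 * l -> 0 < l ->
    1 + (s + (3 / 2 * l - y) ^+ 2) / (2 * (3 / 2 * l) * y) <= 5 / 4.
  by rewrite add0r; apply: key.
move=> sl ly yl l1; have yy : 0 < y by lra.
have : (s + (3 / 2 * l - y) ^+ 2) / (2 * (3 / 2 * l) * y) <= 1 / 4.
  rewrite ler_pdivrMr; first by nra.
  by rewrite !mulr_gt0.
lra.
Qed.

(** [P] gathers the cells reached by the [n] covering balls, so it contains every cell met by the
    projection of [Z]. *)
Lemma TO_le_count (Z : set (R * 'rV[R]_d)) (n : nat) (B : R) :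
  (forall P : seq (cell m), uniq P -> (size P <= n * ball_cell_number m)%N ->
     exists2 h, bounded_lipschitz R m h &
       forall c, (count (crosses R m h c) P)%:R <= B) ->
  (Z `<=` Hyp d)%classic -> Defs.covered_by d Z n -> (TO d q Z <= B%:E)%E.
Proof.
move=> hB ZH [cs [szcs [Hcs covcs]]].
have /choice[bc bcP] : forall p : R * 'rV[R]_d, exists s : seq (cell m),
    (size s <= ball_cell_number m)%N /\ (Hyp d p -> forall p' Q, Hyp d p' ->
      hdist d p p' <= 1 -> in_cell R m Q (shor p') (hgt (r + m) p') -> Q \in s).
  (* Points off the hyperboloid get an empty list; no centre of the cover is one. *)
  move=> p; have [Hp|nHp] := pselect (Hyp d p); last by exists [::]; split.
  have [s s1 s2] := ball_cells R m (shor p) _ (hgt_gt0 _ _ Hp).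
  exists s; split=> // _ p' Q Hp' /(hdist_le1_halfspace _ _ _ Hp Hp')[h1 h2 h3].
  by apply: s2 => // i; exact: h3.
pose P := undup (flatten (map bc cs)).
have szP : (size P <= n * ball_cell_number m)%N.
  apply: (leq_trans (size_undup _)).
  apply: (@leq_trans (size cs * ball_cell_number m)); last by rewrite leq_mul2r szcs orbT.
  by apply: size_flatten_map_le => p; have [] := bcP p.
have [h hL hP] := hB P (undup_uniq _) szP.
apply: (@le_trans _ _ (Ov d q Z (fibered h))).
  by apply: ereal_inf_lbound; exists (fibered h) => //; exact: fibered_cont_on.
apply: ge_ereal_sup => _ [z _ <-]; apply: fibered_fiber_Cov1 hP => // p Q Zp pQ.
have [c ccs cp] := covcs _ Zp; rewrite mem_undup; apply/flattenP.
exists (bc c); first exact: map_f.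
by have [_ /(_ (Hcs _ ccs) p Q (ZH _ Zp) cp pQ)] := bcP c.
Qed.

(** There are at most [M * (t + 1)] cells: for [t > 1] this is below [2 * M * t], and for [t <= 1]
    the cost is absorbed by the additive constant. *)
Lemma lesssim_TOX (G : R -> R) (A B : R) : 0 <= A -> 0 <= B ->
  (forall t, 0 <= t -> 0 <= G t) ->
  (forall s t, 0 <= s -> s <= t -> G s <= G t) ->
  (forall P : seq (cell m), uniq P -> exists2 h, bounded_lipschitz R m h &
     forall c, (count (crosses R m h c) P)%:R <= A * G (size P)%:R + B) ->
  lesssim (TOX d q) G.
Proof.
move=> A0 B0 G0 Gle hP; pose M : R := (ball_cell_number m)%:R.
have M0 : 0 <= M by [].
have GM : 0 <= G (2 * M) by apply: G0; rewrite mulr_ge0.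
exists (A + 2 * M + B + A * G (2 * M) + 1).
set C := _ + 1; have AG : 0 <= A * G (2 * M) by rewrite mulr_ge0.
split=> [|t t0]; first by rewrite /C; lra.
apply: ge_ereal_sup => _ [Z [ZH Zt] <-].
(* The slack 1 extracts an actual cover from the infimum. *)
have : (Cov1 d Z < (t + 1)%:E)%E.
  by apply: (le_lt_trans Zt); rewrite lte_fin; lra.
move=> /ereal_inf_lt[_ [n nZ <-]]; rewrite lte_fin => nt.
apply: (TO_le_count _ n) => // P uP szP.
have [h hL hc] := hP P uP; exists h => // c; apply: (le_trans (hc c)).
have sP : (size P)%:R <= M * (t + 1).
  apply: (@le_trans _ _ (n * ball_cell_number m)%:R); first by rewrite ler_nat.
  by rewrite natrM mulrC ler_wpM2l// ltW.
have Ct : 0 <= G (C * t) by apply: G0; rewrite mulr_ge0// /C; lra.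
have AC : A <= C by rewrite /C; lra.
have BC : B + A * G (2 * M) <= C by rewrite /C; lra.
have [t1|t1] := leP t 1.
  have : G (size P)%:R <= G (2 * M) by apply: Gle => //; nra.
  move=> /(ler_wpM2l A0) h1.
  have : 0 <= C * G (C * t) by rewrite mulr_ge0//; lra.
  by lra.
have h1 : G (size P)%:R <= G (C * t).
  apply: Gle => //; apply: (le_trans sP); apply: (@le_trans _ _ (2 * M * t)); first by nra.
  by rewrite ler_wpM2r// /C; lra.
have h2 : A * G (size P)%:R <= C * G (C * t) by apply: ler_pM => //; exact: G0.
by lra.
Qed.

End upper_bound.

(** * The two growth regimes *)

Theorem theorem1p12 :
  (forall d q : nat, (2 <= q)%N -> (q + 2 <= d)%N ->
     lesssim (TOX d q) (fun r => r `^ (1 - ((d - q)%:R)^-1))) /\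
  (forall d : nat, (2 <= d)%N ->
     lesssim (TOX d (d - 1)) (fun r => ln (1 + r) ^+ 2)).
Proof.
split=> [d q q2 qd|d d2].
  pose m := (d - q)%N; have m1 : (1 < m)%N by rewrite /m; lia.
  have -> : d = (q.-1 + m).+1 by rewrite /m; lia.
  have -> : q = q.-1.+1 by lia.
  have -> : ((q.-1 + m).+1 - q.-1.+1 = m)%N by lia.
  rewrite /=; set al := 1 - _.
  have al0 : 0 < al by rewrite subr_gt0 invf_lt1 ?ltr1n ?ltr0n; lia.
  have [C C0 hC] := power_separator_sum R m m1.
  have [theta t0 ht] := power_contraction R m _ al0.
  have [A A0 hA] := exists_sweepout R m (fun n => n%:R `^ al) (fun n => n%:R `^ al)
    C theta (ltnW m1) t0 C0 (fun n => powR_ge0 _ _) hC ht.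
  apply: (lesssim_TOX _ _ _ A (small_size m)%:R) => // [t _|s t s0 st].
    exact: powR_ge0.
  by apply: ge0_ler_powR; rewrite ?nnegrE ?(ltW al0)// (le_trans s0).
(* Codimension one, [m = 1]: a separator costs [ln (1 + N)] and the recursion sums to its square. *)
have -> : d = ((d - 2) + 1).+1 by lia.
have -> : ((d - 2 + 1).+1 - 1 = (d - 2).+1)%N by lia.
have [C C0 hC] := log_separator_sum R 1 erefl.
have [theta t0 ht] := log_contraction R 1.
have [A A0 hA] := exists_sweepout R 1 (fun n => ln (1 + n%:R) ^+ 2)
  (fun n => ln (1 + n%:R)) C theta isT t0 C0 (fun n => sqr_ge0 _) hC ht.
apply: (lesssim_TOX _ _ _ A (small_size 1)%:R) => // [t _|s t s0 st].
  exact: sqr_ge0.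
have h1 : 0 <= ln (1 + s) by rewrite ln_ge0//; lra.
have h2 : ln (1 + s) <= ln (1 + t) by rewrite ler_ln ?posrE; lra.
by rewrite lerXn2r ?nnegrE// (le_trans h1).
Qed.
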